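(* Let $\mathcal V$ be a quantale, let $F\colon \mathsf{Set}\to\mathsf{Set}$ be a functor, and let $\widehat F$ be a lax extension of $F$ to $\mathcal V\text{-}\mathsf{Rel}$. Then $\widehat F$ is induced by its class of Moss liftings; that is, $\widehat F=\widehat F^{M}$ for $M=\{\mu^{\mathfrak k}\mid \kappa \text{ a cardinal},\ \mathfrak k\in F\kappa\}$.
   Context: A quantale $\mathcal V$ is a complete lattice with a commutative monoid structure $(\otimes,k)$ such that each $u\otimes-$ preserves suprema; $\hom(u,-)$ denotes the right adjoint of $u\otimes -$. A $\mathcal V$-relation $r\colon X\nrightarrow Y$ is a map $X\times Y\to\mathcal V$. For $r\colon X\nrightarrow Y$, $s\colon Y\nrightarrow Z$, the composite is $(s\cdot r)(x,z)=\bigvee_{y}r(x,y)\otimes s(y,z)$; $1_X$ has value $k$ on the diagonal and $\bot$ elsewhere; $\mathcal V\text{-}\mathsf{Rel}$ is the category of sets and $\mathcal V$-relations. $\mathcal V$-relations are ordered pointwise; $r^\circ(y,x)=r(x,y)$ is the converse. A function $f\colon X\to Y$ is regarded as the $\mathcal V$-relation with value $k$ on the graph of $f$ and $\bot$ elsewhere. An element of a set $A$ is regarded as a function $1\to A$. For $q\colon Z\nrightarrow Y$ and $r\colon X\nrightarrow Y$, the lift $q\backslash r\colon X\nrightarrow Z$ is $(q\backslash r)(x,z)=\bigwedge_{y}\hom(q(z,y),r(x,y))$. A lax extension of $F$ to $\mathcal V\text{-}\mathsf{Rel}$ is an assignment $(r\colon X\nrightarrow Y)\mapsto(\widehat Fr\colon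 FX\nrightarrow FY)$ such that (L1) $r\le r'$ implies $\widehat Fr\le\widehat Fr'$; (L2) $\widehat Fs\cdot\widehat Fr\le\widehat F(s\cdot r)$; (L3) $Ff\le\widehat Ff$ and $(Ff)^\circ\le\widehat F(f^\circ)$ for all functions $f$. For a cardinal $\kappa$, a $\kappa$-ary predicate lifting $\mu$ for $F$ is a family of maps sending $\mathcal V$-relations $r\colon X\nrightarrow\kappa$ to $\mathcal V$-relations $\mu(r)\colon FX\nrightarrow1$, natural in $X$: $\mu(r\cdot f)=\mu(r)\cdot Ff$ for all functions $f\colon X\to Y$ and $r\colon Y\nrightarrow\kappa$ (equivalently, a natural transformation $\mathsf{Set}(-,\mathcal V^\kappa)\to\mathsf{Set}(F-,\mathcal V)$). It is monotone if $r\le r'$ implies $\mu(r)\le\mu(r')$. For $\mathfrak k\in F\kappa$, the Moss lifting $\mu^{\mathfrak k}$ of $\widehat F$ is $\mu^{\mathfrak k}(f)=\mathfrak k^\circ\cdot\widehat Ff$ for $f\colon X\nrightarrow\kappa$; it is monotone. For a monotone $\kappa$-ary predicate lifting $\mu$ and $r\colon X\nrightarrow Y$, put $\widehat F^\mu r=\bigwedge_{g\colon Y\nrightarrow\kappa}\mu(g)\backslash\mu(g\cdot r)\colon FX\nrightarrow FY$. For a class $M$ of monotone predicate liftings, the Kantorovich extension is $\widehat F^M=\bigwedge_{\mu\in M}\widehat F^\mu$. A lax extension is induced by $M$ if it equals $\widehat F^M$. *)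

(* Defs.v *)
From HB Require Import structures.
From mathcomp Require Import all_boot all_order.
From mathcomp Require Import boolp classical_sets cardinality.
From mathcomp Require wochoice.

Set Implicit Arguments.
Unset Strict Implicit.
Unset Printing Implicit Defensive.

Import Order.TTheory.
Local Open Scope classical_set_scope.
Local Open Scope order_scope.

HB.mixin Record POrder_isCompleteLattice d V & Order.POrder d V := {
  qsup : set V -> V;
  qsup_subproof : forall A : set V, supremums A (qsup A)
}.

#[short(type="completeLatticeType")]
HB.structure Definition CompleteLattice d :=
  { V of POrder_isCompleteLattice d V & Order.POrder d V }.

HB.mixin Record CompleteLattice_isQuantale d V & CompleteLattice d V := {
  tens : V -> V -> V;
  qone : V;
  tensA : associative tens;
  tensC : commutative tens;
  tens1q : left_id qone tens;
  tens_sup : forall (u : V) (A : set V),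
    tens u (qsup A) = qsup [set tens u v | v in A]
}.

#[short(type="quantaleType")]
HB.structure Definition Quantale d :=
  { V of CompleteLattice_isQuantale d V & CompleteLattice d V }.

Arguments qone {d s}.

Notation "u ⊗ v" := (tens u v) (at level 40, left associativity).

Section QuantaleOps.
Context {d : Order.disp_t} {V : quantaleType d}.
Implicit Types (u v w : V) (A : set V).

Definition qinf A : V := qsup (lbound A).
Definition qbot : V := qsup set0.
Definition qhom u v : V := qsup [set w | u ⊗ w <= v].

Lemma qsup_ub A v : A v -> v <= qsup A.
Proof. by move=> Av; have [ubA _] := qsup_subproof A; exact: ubA. Qed.

Lemma qsup_le A u : ubound A u -> qsup A <= u.
Proof. by move=> Au; have [_ lbA] := qsup_subproof A; exact: lbA. Qed.

Lemma qinf_lb A v : A v -> qinf A <= v.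
Proof. by move=> Av; apply: qsup_le => w; apply. Qed.

Lemma qinf_ge A u : lbound A u -> u <= qinf A.
Proof. exact: qsup_ub. Qed.

Lemma qbot_le u : qbot <= u.
Proof. exact: qsup_le. Qed.

Lemma tens_le u v w : v <= w -> u ⊗ v <= u ⊗ w.
Proof.
move=> vw; have -> : w = qsup [set v; w].
  apply/le_anti/andP; split; first by apply: qsup_ub; right.
  by apply: qsup_le => z [] ->.
by rewrite tens_sup; apply: qsup_ub; exists v => //; left.
Qed.

Lemma tens_le2 u u' v v' : u <= u' -> v <= v' -> u ⊗ v <= u' ⊗ v'.
Proof.
by move=> uu' /(tens_le u) /le_trans; apply; rewrite tensC [leRHS]tensC tens_le.
Qed.

Lemma tensq1 u : u ⊗ qone = u.
Proof. by rewrite tensC tens1q. Qed.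

Lemma tensq0 u : u ⊗ qbot = qbot.
Proof. by rewrite /qbot tens_sup image_set0. Qed.

Lemma tens0q u : qbot ⊗ u = qbot.
Proof. by rewrite tensC tensq0. Qed.

Lemma qhomP u v w : (u ⊗ w <= v) = (w <= qhom u v).
Proof.
apply/idP/idP => [uwv|whom]; first exact: qsup_ub.
apply: (le_trans (tens_le u whom)).
by rewrite tens_sup; apply: qsup_le => _ [z uzv <-].
Qed.

End QuantaleOps.

(* A single universe of sets, so that functors are endofunctors. *)
Definition Sets := Type.

Record functor := Functor {
  fobj :> Sets -> Sets;
  fmap : forall X Y : Sets, (X -> Y) -> fobj X -> fobj Y;
  fmap_id : forall X : Sets, fmap (@id X) = id;
  fmap_comp : forall (X Y Z : Sets) (g : Y -> Z) (f : X -> Y),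
    fmap (g \o f) = fmap g \o fmap f
}.

Arguments fmap F {X Y} f _ : rename.

(* Cardinals as initial well-orders: no proper initial segment has at least
   as many elements as the whole set. This is the usual set-theoretic notion
   up to order isomorphism. *)
Record cardinal := Cardinal {
  csort :> Sets;
  cle : rel csort;
  cle_wo : wochoice.well_order cle;
  cle_initial : forall a : csort,
    ~ ([set: csort] #<= [set b | cle b a /\ b <> a])%card
}.

Definition vrel d (V : quantaleType d) (X Y : Sets) := X -> Y -> V.

Section VRel.
Context {d : Order.disp_t} {V : quantaleType d}.

Definition vle (X Y : Sets) (r s : vrel V X Y) := forall x y, r x y <= s x y.

Definition vcomp (X Y Z : Sets) (s : vrel V Y Z) (r : vrel V X Y) :
    vrel V X Z :=
  fun x z => qsup [set r x y ⊗ s y z | y in setT].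

Definition vconv (X Y : Sets) (r : vrel V X Y) : vrel V Y X := fun y x => r x y.

Definition vgraph (X Y : Sets) (f : X -> Y) : vrel V X Y :=
  fun x y => if `[< f x = y >] then qone else qbot.

Definition vpoint (A : Sets) (a : A) : vrel V unit A := vgraph (fun=> a).

Definition vmeet (X Y : Sets) (S : set (vrel V X Y)) : vrel V X Y :=
  fun x y => qinf [set r x y | r in S].

Definition vlift (X Y Z : Sets) (q : vrel V Z Y) (r : vrel V X Y) :
    vrel V X Z :=
  fun x z => qinf [set qhom (q z y) (r x y) | y in setT].

End VRel.

Notation "s ⊙ r" := (vcomp s r) (at level 40, left associativity).
Notation "q \\ r" := (vlift q r) (at level 40, no associativity).

Section Liftings.
Context {d : Order.disp_t} (V : quantaleType d) (F : functor).

Record lax_extension := LaxExtension {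
  lext :> forall X Y : Sets, vrel V X Y -> vrel V (F X) (F Y);
  lext_mono : forall (X Y : Sets) (r r' : vrel V X Y),
    vle r r' -> vle (lext r) (lext r');
  lext_comp : forall (X Y Z : Sets) (r : vrel V X Y) (s : vrel V Y Z),
    vle (lext s ⊙ lext r) (lext (s ⊙ r));
  lext_graph : forall (X Y : Sets) (f : X -> Y),
    vle (vgraph (fmap F f)) (lext (vgraph f));
  lext_conv : forall (X Y : Sets) (f : X -> Y),
    vle (vconv (vgraph (fmap F f))) (lext (vconv (vgraph f)))
}.

Record pred_lifting (kappa : cardinal) := PredLifting {
  plift :> forall X : Sets, vrel V X kappa -> vrel V (F X) unit;
  plift_natural : forall (X Y : Sets) (f : X -> Y) (r : vrel V Y kappa),
    plift (r ⊙ vgraph f) = plift r ⊙ vgraph (fmap F f)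
}.

Record monotone_lifting (kappa : cardinal) := MonotoneLifting {
  mlift :> pred_lifting kappa;
  mlift_mono : forall (X : Sets) (r r' : vrel V X kappa),
    vle r r' -> vle (mlift X r) (mlift X r')
}.

Definition lifting_class :=
  forall kappa : cardinal, set (monotone_lifting kappa).

Definition kantorovich1 (kappa : cardinal) (mu : monotone_lifting kappa)
    (X Y : Sets) (r : vrel V X Y) : vrel V (F X) (F Y) :=
  vmeet [set mu Y g \\ mu X (g ⊙ r) | g in [set: vrel V Y kappa]].

Definition kantorovich (M : lifting_class) (X Y : Sets) (r : vrel V X Y) :
    vrel V (F X) (F Y) :=
  vmeet [set s | exists (kappa : cardinal) (mu : monotone_lifting kappa),
                   M kappa mu /\ s = kantorovich1 mu r].

Definition induced_by (hatF : lax_extension) (M : lifting_class) :=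
  forall (X Y : Sets) (r : vrel V X Y), hatF X Y r = kantorovich M r.

End Liftings.

Section VRelTheory.
Context {d : Order.disp_t} {V : quantaleType d}.

Lemma vle_anti (X Y : Sets) (r s : vrel V X Y) : vle r s -> vle s r -> r = s.
Proof.
by move=> rs sr; apply/funext => x; apply/funext => y; apply/le_anti; rewrite rs sr.
Qed.

Lemma vle_refl (X Y : Sets) (r : vrel V X Y) : vle r r.
Proof. by move=> x y. Qed.

Lemma vle_trans (X Y : Sets) (r s t : vrel V X Y) :
  vle r s -> vle s t -> vle r t.
Proof. by move=> rs st x y; exact: le_trans (rs x y) (st x y). Qed.

Lemma vcomp_le (X Y Z : Sets) (s s' : vrel V Y Z) (r r' : vrel V X Y) :
  vle s s' -> vle r r' -> vle (s ⊙ r) (s' ⊙ r').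
Proof.
move=> ss' rr' x z; apply: qsup_le => _ [y _ <-].
by apply: (le_trans (tens_le2 (rr' x y) (ss' y z))); apply: qsup_ub; exists y.
Qed.

Lemma vcompA (X Y Z W : Sets) (t : vrel V Z W) (s : vrel V Y Z)
    (r : vrel V X Y) :
  t ⊙ (s ⊙ r) = t ⊙ s ⊙ r.
Proof.
apply: vle_anti => x w; apply: qsup_le => _ [y _ <-].
  rewrite tensC tens_sup; apply: qsup_le => _ [_ [z _ <-] <-].
  rewrite tensC -tensA.
  apply: (@le_trans _ _ (r x z ⊗ (t ⊙ s) z w)).
    by apply: tens_le; apply: qsup_ub; exists y.
  by apply: qsup_ub; exists z.
rewrite tens_sup; apply: qsup_le => _ [_ [z _ <-] <-].
rewrite tensA; apply: (@le_trans _ _ ((s ⊙ r) x z ⊗ t z w)).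
  by apply: tens_le2 => //; apply: qsup_ub; exists y.
by apply: qsup_ub; exists z.
Qed.

Lemma vcomp_graphE (X Y Z : Sets) (f : X -> Y) (r : vrel V Y Z) x z :
  (r ⊙ vgraph f) x z = r (f x) z.
Proof.
apply/le_anti/andP; split.
  apply: qsup_le => _ [y _ <-]; rewrite /vgraph.
  case: asboolP => [->|_]; first by rewrite tens1q.
  by rewrite tens0q qbot_le.
by apply: qsup_ub; exists (f x) => //; rewrite /vgraph asboolT// tens1q.
Qed.

Lemma vcomp_convE (X Y Z : Sets) (f : Z -> Y) (r : vrel V X Y) x z :
  (vconv (vgraph f) ⊙ r) x z = r x (f z).
Proof.
apply/le_anti/andP; split.
  apply: qsup_le => _ [y _ <-]; rewrite /vconv /vgraph.
  case: asboolP => [->|_]; first by rewrite tensq1.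
  by rewrite tensq0 qbot_le.
by apply: qsup_ub; exists (f z) => //; rewrite /vconv /vgraph asboolT// tensq1.
Qed.

End VRelTheory.

Section Moss.
Context {d : Order.disp_t} {V : quantaleType d} {F : functor}.
Variable hatF : lax_extension V F.

Lemma lext_compr (X Y Z : Sets) (f : X -> Y) (r : vrel V Y Z) :
  hatF X Z (r ⊙ vgraph f) = hatF Y Z r ⊙ vgraph (fmap F f).
Proof.
apply: vle_anti; last first.
  apply: vle_trans (lext_comp hatF _ _); apply: vcomp_le; first exact: vle_refl.
  exact: lext_graph.
move=> x z; rewrite vcomp_graphE.
have rff : vle (r ⊙ vgraph f ⊙ vconv (vgraph f)) r.
  move=> y w; apply: qsup_le => _ [x' _ <-]; rewrite vcomp_graphE /vconv /vgraph.
  case: asboolP => [->|_]; first by rewrite tens1q.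
  by rewrite tens0q qbot_le.
apply: (le_trans _ (lext_mono hatF rff (fmap F f x) z)).
apply: (le_trans _ (lext_comp hatF (vconv (vgraph f)) (r ⊙ vgraph f) _ _)).
apply: (@le_trans _ _
  ((hatF X Z (r ⊙ vgraph f) ⊙ vconv (vgraph (fmap F f))) (fmap F f x) z)).
  apply: qsup_ub; exists x => //.
  by rewrite /vconv /vgraph asboolT// tens1q.
by apply: vcomp_le; [exact: vle_refl|exact: lext_conv].
Qed.

Definition moss_fun (kappa : cardinal) (k : F kappa) (X : Sets)
    (f : vrel V X kappa) : vrel V (F X) unit :=
  vconv (vpoint k) ⊙ hatF X kappa f.

Lemma moss_natural (kappa : cardinal) (k : F kappa) (X Y : Sets) (f : X -> Y)
    (r : vrel V Y kappa) :
  moss_fun k (r ⊙ vgraph f) = moss_fun k r ⊙ vgraph (fmap F f).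
Proof. by rewrite /moss_fun lext_compr vcompA. Qed.

Lemma moss_mono (kappa : cardinal) (k : F kappa) (X : Sets)
    (r r' : vrel V X kappa) :
  vle r r' -> vle (moss_fun k r) (moss_fun k r').
Proof. by move=> rr'; apply: vcomp_le => //; exact: lext_mono. Qed.

Definition moss (kappa : cardinal) (k : F kappa) : monotone_lifting V F kappa :=
  @MonotoneLifting d V F kappa (PredLifting (@moss_natural kappa k))
    (@moss_mono kappa k).

Definition moss_liftings : lifting_class V F :=
  fun kappa => [set moss k | k in [set: F kappa]].

End Moss.

(* Main.v *)
Require Import Defs.
From mathcomp Require Import all_boot all_order.
From mathcomp Require Import boolp classical_sets functions cardinality.
From mathcomp Require wochoice.

Set Implicit Arguments.
Unset Strict Implicit.
Unset Printing Implicit Defensive.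

Import Order.TTheory.
Local Open Scope classical_set_scope.
Local Open Scope order_scope.

(** Two inequalities have to be shown.

    That hatF r lies below kantorovich M r is lax functoriality read through
    the adjunction between tensor and hom: it comes down to
    hatF r x y ⊗ hatF g y k <= hatF (g ⊙ r) x k for every test relation g and
    every point k (lext_le_kantorovich1_moss).

    For the converse at r : X -/-> Y, one Moss lifting and one test relation
    suffice for each pair (x, y) (kantorovich1_moss_le_lext). Embed Y in a
    cardinal by an injection f, take the lifting of the point F f y, and test
    with the graph of f. The lifted graph is at least the unit at y, because
    hatF extends F on functions, so the hom that bounds the Kantorovich
    extension is at most hatF (f ⊙ r) x (F f y). Since f° ⊙ f is the identity
    for an injective f, laxness on converses and on composites brings this
    value below hatF r x y.

    The choice of f requires that every set embeds in a cardinal, where a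
    cardinal is an initial well-order carried by a set (exists_cardinal_inj).
    This follows by cutting down a well-order on the set to a smallest part
    that is still as large as the whole. *)

(** * Embedding a set in a cardinal *)

Lemma card_leT_inj (T U : Type) :
  ([set: T] #<= [set: U])%card -> exists f : T -> U, injective f.
Proof.
move=> /card_leP[f]; exists (fun x => val (f (to_setT x))) => x y.
by move=> /val_inj/(inj (in_setT _) (in_setT _))/(congr1 val).
Qed.

Lemma sub_well_order (T : Type) (R : rel T) (A : set T) :
  wochoice.well_order R ->
  wochoice.well_order (fun x y : {x | x \in A} => R (val x) (val y)).
Proof.
move=> Rwo P [x Px].
have [|z [[]]] := Rwo [pred y | `[< exists2 y', y' \in P & val y' = y >]].
  by exists (val x); apply/asboolP; exists x.
move=> /asboolP[z' Pz' <-] zmin zuniq; exists z'; split.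
  by split=> // y Py; apply: zmin; apply/asboolP; exists y.
move=> y [Py ymin]; apply/val_inj/zuniq; split; first by apply/asboolP; exists y.
by move=> _ /asboolP[w Pw <-]; exact: ymin.
Qed.

Lemma well_order_refl (T : eqType) (R : rel T) :
  wochoice.well_order R -> reflexive R.
Proof.
move=> Rwo x.
exact: (wochoice.wo_chain_reflexive (wochoice.withinW (A := predT) Rwo)).
Qed.

Lemma well_order_anti (T : eqType) (R : rel T) :
  wochoice.well_order R -> antisymmetric R.
Proof.
move=> Rwo x y.
exact: (wochoice.wo_chain_antisymmetric (wochoice.withinW (A := predT) Rwo)).
Qed.

(** Well-order Y and stop just before the first point b whose segment is as
    large as Y, if there is one. What remains contains the segment of b, so Y
    still embeds in it; and it is initial, because one of its segments as large
    as itself would also be as large as Y. *)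
Lemma exists_cardinal_inj (Y : Sets) :
  exists (kappa : cardinal) (f : Y -> csort kappa), injective f.
Proof.
have [R Rwo] := wochoice.well_ordering_principle {classic Y}.
have Rrefl := well_order_refl Rwo; have Ranti := well_order_anti Rwo.
pose seg (b : Y) := [set c : Y | R c b /\ c <> b].
pose A := [set y : Y | forall b, R b y -> ~ ([set: Y] #<= seg b)%card].
have YA : ([set: Y] #<= A)%card.
  have [[a Aa]|noA] := pselect (exists a, ~ A a); last first.
    by apply: subset_card_le => y _; apply: contrapT => Ay; apply: noA; exists y.
  (* [m] is the least point outside [A]; it is the first point with a segment
     as large as [Y], and all earlier points are in [A]. *)
  have [|m [[/asboolP Am mmin] _]] := Rwo [pred y | `[< ~ A y >]].
    by exists a; apply/asboolP.
  have {}mmin y : ~ A y -> R m y by move=> Ay; apply: mmin; apply/asboolP.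
  move: Am => /existsNP[b /not_implyP[bm /contrapT Yb]].
  have mb : m = b.
    apply: Ranti; rewrite bm andbT; apply: mmin => /(_ b).
    by move=> /(_ (Rrefl b)); apply.
  apply: (card_le_trans Yb); apply: subset_card_le => c [cb cnb].
  apply: contrapT => /mmin mc; apply: cnb; apply: Ranti.
  by rewrite cb -mb.
(* [B] is [set_type A] unfolded: the subset type of [Y] itself stays in the
   universe [Sets], whereas the constant [set_type] has a larger one. *)
pose B : Sets := {y : Y | y \in A}.
have initA (a : B) :
    ~ ([set: B] #<= [set b : B | R (val b) (val a) /\ b <> a])%card.
  move=> Aa; have /set_mem/(_ _ (Rrefl _)) := valP a; apply.
  apply: (card_le_trans YA); rewrite -(card_le_eql (card_setT A)).
  apply: (card_le_trans Aa).
  rewrite -(card_le_eql (inj_card_eq (in2W val_inj))).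
  apply: subset_card_le => _ [b [ba bna] <-]; split=> //.
  by move=> /val_inj.
exists (@Cardinal B _ (sub_well_order Rwo) initA); apply: card_leT_inj => /=.
by rewrite (card_le_eqr (card_setT A)).
Qed.

(** * The extension and its Moss liftings *)

Section MossInduces.
Context {d : Order.disp_t} {V : quantaleType d} {F : functor}.
Variable hatF : lax_extension V F.

Lemma moss_funE (kappa : cardinal) (k : F kappa) (X : Sets)
    (g : vrel V X kappa) x u :
  moss_fun hatF k g x u = hatF X kappa g x k.
Proof. exact: vcomp_convE. Qed.

(** By adjunction, the claim for a test relation g is the inequality
    hatF r x y ⊗ hatF g y k <= hatF (g ⊙ r) x k, one term of the supremum that
    defines the composite hatF g ⊙ hatF r. *)
Lemma lext_le_kantorovich1_moss (kappa : cardinal) (k : F kappa) (X Y : Sets)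
    (r : vrel V X Y) :
  vle (hatF X Y r) (kantorovich1 (moss hatF k) r).
Proof.
move=> x y; apply: qinf_ge => _ [_ [g _ <-] <-].
apply: qinf_ge => _ [u _ <-].
rewrite -qhomP /= !moss_funE tensC.
apply: le_trans (lext_comp hatF r g x k).
by apply: qsup_ub; exists y.
Qed.

Lemma vconv_graph_comp_inj (X Y Z : Sets) (f : Y -> Z) (r : vrel V X Y) :
  injective f -> vconv (vgraph f) ⊙ (vgraph f ⊙ r) = r.
Proof.
move=> finj; apply/funext => x; apply/funext => y; rewrite vcomp_convE.
apply/le_anti/andP; split.
  apply: qsup_le => _ [z _ <-]; rewrite /vgraph.
  case: asboolP => [/finj ->|_]; first by rewrite tensq1.
  by rewrite tensq0 qbot_le.
by apply: qsup_ub; exists y => //; rewrite /vgraph asboolT// tensq1.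
Qed.

(** Evaluating at F f y is composing with the converse of F f, which lies below
    hatF f°; and f° ⊙ f ⊙ r is r again. *)
Lemma lext_graph_comp_inj (X Y Z : Sets) (f : Y -> Z) (r : vrel V X Y) x y :
  injective f -> hatF X Z (vgraph f ⊙ r) x (fmap F f y) <= hatF X Y r x y.
Proof.
move=> finj; rewrite -{2}(vconv_graph_comp_inj r finj) -vcomp_convE.
apply: (le_trans _ (lext_comp hatF _ _ x y)).
by apply: vcomp_le; [exact: lext_conv|exact: vle_refl].
Qed.

Lemma qone_le_lext_graph (X Y : Sets) (f : X -> Y) x :
  qone <= hatF X Y (vgraph f) x (fmap F f x).
Proof.
by apply: le_trans (lext_graph hatF f x _); rewrite /vgraph asboolT.
Qed.

(** Only the instance of the meet at the graph of f is used. It is a hom out of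
    an element above the unit, hence is at most the target of that hom. *)
Lemma kantorovich1_moss_le_lext (kappa : cardinal) (X Y : Sets)
    (f : Y -> csort kappa) (r : vrel V X Y) x y :
  injective f ->
  kantorovich1 (moss hatF (fmap F f y)) r x y <= hatF X Y r x y.
Proof.
move=> finj; set mu := moss _ _.
apply: (@le_trans _ _ ((mu Y (vgraph f) \\ mu X (vgraph f ⊙ r)) x y)).
  by apply: qinf_lb; exists (mu Y (vgraph f) \\ mu X (vgraph f ⊙ r)).
apply: (@le_trans _ _ (qhom (mu Y (vgraph f) y tt) (mu X (vgraph f ⊙ r) x tt))).
  by apply: qinf_lb; exists tt.
rewrite /= !moss_funE; apply: le_trans (lext_graph_comp_inj r x y finj).
rewrite -[leLHS]tens1q.
apply: le_trans (tens_le2 (qone_le_lext_graph f y) (lexx _)) _.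
by rewrite qhomP.
Qed.

End MossInduces.

Theorem theorem4p18 (d : Order.disp_t) (V : quantaleType d) (F : functor)
  (hatF : lax_extension V F) : induced_by hatF (moss_liftings hatF).
Proof.
move=> X Y r; apply: vle_anti => x y.
  apply: qinf_ge => _ [_ [kappa [_ [[k _ <-] ->]]] <-].
  exact: lext_le_kantorovich1_moss.
have [kappa [f finj]] := exists_cardinal_inj Y.
apply: le_trans (kantorovich1_moss_le_lext hatF r x y finj).
apply: qinf_lb; exists (kantorovich1 (moss hatF (fmap F f y)) r) => //.
by exists kappa, (moss hatF (fmap F f y)); split=> //; exists (fmap F f y).
Qed.
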